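(* Fix $h_1,\dots,h_K\in\mathbb{C}\setminus\{0\}$, $P_W,P_X,N_0>0$, $\rho_X=P_X/N_0$, $\epsilon>0$, $\eta>0$ and $\delta\in(0,1)$. Suppose the source message length $L$ satisfies $$L\ge\frac{\ln(1/\delta)}{\eta-\ln(1+\eta)},$$ and the coding rate $R=L/\tilde L$ satisfies $$0<R\le\min\left\{1,\ \frac{\epsilon\,\rho_X\min_k|h_k|^2}{(1+\eta)P_W}\right\}.$$ Then under the optimal coding scheme (admissible encoding matrix with $\boldsymbol{\Phi}^{\mathsf H}\boldsymbol{\Phi}=\mathbf{I}_L$ and power scaling $P=P^*=\frac{P_X\min_k|h_k|^2}{RP_W}$), one has $\epsilon\ge(1+\eta)\gamma_{\mathrm{opt}}$ with $\gamma_{\mathrm{opt}}=\frac{RP_W}{\rho_X\min_k|h_k|^2}$, and $$\Pr\big(d(\mathbf{w},\hat{\mathbf{w}})\le\epsilon\big)\ge1-\delta.$$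
   Context: System model (channel-coded over-the-air computation). There are $K$ users; user $k$ holds a random source message $\mathbf{w}_k\in\mathbb{C}^L$, with $\mathbf{w}_1,\dots,\mathbf{w}_K$ independent and $\mathbf{w}_k\sim\mathcal{CN}(\mathbf{0},P_W\mathbf{I}_L)$; $\mathbf{w}=\sum_k\mathbf{w}_k$. An admissible encoding matrix is $\boldsymbol{\Phi}\in\mathbb{C}^{\tilde L\times L}$, $\tilde L\ge L$, with $\mathrm{tr}(\boldsymbol{\Phi}^{\mathsf H}\boldsymbol{\Phi})=L$ and such that every $L\times L$ submatrix formed by $L$ rows of $\boldsymbol{\Phi}$ has rank $L$. Coding rate $R=L/\tilde L$. User $k$ transmits $\mathbf{x}_k=\frac{\sqrt{P}}{h_k}\boldsymbol{\Phi}\mathbf{w}_k$; the base station receives $\mathbf{y}=\sqrt{P}\boldsymbol{\Phi}\mathbf{w}+\mathbf{n}$ with $\mathbf{n}\sim\mathcal{CN}(\mathbf{0},N_0\mathbf{I}_{\tilde L})$ independent of the messages, and estimates $\hat{\mathbf{w}}=\boldsymbol{\Phi}^{\dagger}\mathbf{y}/\sqrt{P}$. The power constraint is $\frac{LPP_W}{\tilde L|h_k|^2}\le P_X$ for all $k$. Distortion $d(\mathbf{w},\hat{\mathbf{w}})=\frac1L\|\hat{\mathbf{w}}-\mathbf{w}\|^2$. *)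

(* Defs.v *)
From HB Require Import structures.
From mathcomp Require Import all_boot all_order all_algebra.
From mathcomp Require Import all_classical all_reals all_analysis.
From mathcomp Require Import complex.
Set Implicit Arguments. Unset Strict Implicit. Unset Printing Implicit Defensive.
Import Order.TTheory GRing.Theory Num.Theory.
Local Open Scope classical_set_scope.
Local Open Scope ring_scope.

Section Defs.
Variable R : realType.
Local Notation C := (R[i]).

Definition abs2 (z : C) : R := complex.Re z ^+ 2 + complex.Im z ^+ 2.

Definition ctrmx m n (A : 'M[C]_(m, n)) : 'M[C]_(n, m) := map_mx (@conjc R) A^T.

(* X is the Moore-Penrose pseudo-inverse of A (Penrose conditions; unique) *)
Definition is_pinv m n (A : 'M[C]_(m, n)) (X : 'M[C]_(n, m)) : Prop :=
  [/\ A *m X *m A = A, X *m A *m X = X,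
      ctrmx (A *m X) = A *m X & ctrmx (X *m A) = X *m A].

Definition admissible L Lt (Phi : 'M[C]_(Lt, L)) : Prop :=
  (L <= Lt)%N /\ \tr (ctrmx Phi *m Phi) = L%:R /\
  forall f : 'I_L -> 'I_Lt, injective f -> \rank (rowsub f Phi) = L.

(* min_k |h_k|^2 (meaningful for K > 0) *)
Definition min_gain K (h : 'I_K -> C) : R :=
  \big[Num.min/ head 0 [seq abs2 (h k) | k <- enum 'I_K]]_(k < K) abs2 (h k).

Definition mutually_independent d (T : measurableType d) (P : probability T R)
  (J : finType) (X : J -> T -> R) : Prop :=
  (forall j, measurable_fun setT (X j)) /\
  forall B : J -> set R, (forall j, measurable (B j)) ->
    P (\bigcap_(j in setT) (X j @^-1` B j)) = (\prod_(j : J) P (X j @^-1` B j))%E.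

Definition is_normal0 d (T : measurableType d) (P : probability T R)
  (v : R) (X : T -> R) : Prop :=
  forall B, measurable B -> P (X @^-1` B) = normal_prob 0 (Num.sqrt v) B.

Definition cpart (b : bool) (z : C) : R := if b then complex.Re z else complex.Im z.

Definition components d (T : measurableType d) K L Lt
  (w : 'I_K -> T -> 'cV[C]_L) (n : T -> 'cV[C]_Lt)
  (j : ((('I_K * 'I_L) + 'I_Lt) * bool)%type) : T -> R :=
  fun t => match j with
           | (inl (k, i), b) => cpart b (w k t i 0)
           | (inr i, b) => cpart b (n t i 0)
           end.

(* w_1..w_K, n independent; w_k ~ CN(0, PW I_L); n ~ CN(0, N0 I_Lt):
   i.e. all real/imaginary parts are independent, with variance PW/2 resp. N0/2 *)
Definition gaussian_model d (T : measurableType d) (P : probability T R) K L Lt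
  (w : 'I_K -> T -> 'cV[C]_L) (n : T -> 'cV[C]_Lt) (PW N0 : R) : Prop :=
  mutually_independent P (components w n) /\
  (forall k i b, is_normal0 P (PW / 2) (components w n (inl (k, i), b))) /\
  (forall i b, is_normal0 P (N0 / 2) (components w n (inr i, b))).

Definition received d (T : measurableType d) K L Lt (Phi : 'M[C]_(Lt, L))
  (Pw : R) (w : 'I_K -> T -> 'cV[C]_L) (n : T -> 'cV[C]_Lt) (t : T) : 'cV[C]_Lt :=
  (Num.sqrt Pw)%:C%C *: (Phi *m (\sum_k w k t)) + n t.

Definition estimate d (T : measurableType d) K L Lt (Phi : 'M[C]_(Lt, L))
  (Phid : 'M[C]_(L, Lt)) (Pw : R) (w : 'I_K -> T -> 'cV[C]_L)
  (n : T -> 'cV[C]_Lt) (t : T) : 'cV[C]_L :=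
  ((Num.sqrt Pw)%:C%C)^-1 *: (Phid *m received Phi Pw w n t).

Definition distortion L (x xh : 'cV[C]_L) : R :=
  (L%:R)^-1 * \sum_(i < L) abs2 (xh i 0 - x i 0).

End Defs.

(* Main.v *)
(* Since Phi^H Phi = 1, the pseudo-inverse is Phi^H, so the estimation error is
   Phi^H n / sqrt Pstar and the distortion is |Phi^H n|^2 / (L Pstar).  The 2L real
   coordinates Z_p of Phi^H n behave like independent centred Gaussians of
   variance v = N0/2, and the Chernoff bound with exponent
   s = eta / ((1 + eta) N0) gives exactly
   Pr(d > eps) <= (1 + eta)^L exp(- L eta) <= delta.

   Rotation invariance of the Gaussian law is never used.  The moment generating
   function of the vector (Z_p) follows from the independence of the noise
   components and |Phi y| = |y|; the exponential moment of sum_p Z_p^2 is then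
   computed one coordinate at a time by writing exp(s z^2) as the average of
   exp(x z) over x ~ N(0, 2s) and exchanging the two integrals. *)
Require Import Defs.
From HB Require Import structures.
From mathcomp Require Import all_boot all_order all_algebra.
From mathcomp Require Import all_classical all_reals all_analysis.
From mathcomp Require Import complex.
From mathcomp Require Import measurable_realfun.
From mathcomp Require Import ring lra.
Import Order.TTheory GRing.Theory Num.Theory.
Local Open Scope classical_set_scope.
Local Open Scope ring_scope.

Local Notation mu := lebesgue_measure.

(** * Layer-cake formula and transfer of integrals between weighted laws *)

Section transfer.
Context {R : realType}.

Lemma integral_subgraph (r : R) : 0 <= r ->
  (\int[mu]_t (\1_`[0%R, r[ t)%:E = r%:E)%E.
Proof.
move=> r0; rewrite integral_indic ?setIT//= lebesgue_measure_itv/= lte_fin.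
by case: ltgtP r0 => // [_|<-] _; rewrite ?oppr0 ?adde0.
Qed.

Lemma measurable_set_bool d (Y : measurableType d) (b : Y -> bool) :
  measurable_fun setT b -> measurable [set y | b y].
Proof.
move=> mb; rewrite -[X in measurable X]setTI.
have -> : [set y | b y] = b @^-1` [set true].
  by apply/seteqP; split => y /=; case: (b y).
exact: mb.
Qed.

Lemma measurable_subgraph d (Y : measurableType d) (f : Y -> R) :
  measurable_fun setT f ->
  measurable [set p : Y * R | (0 <= p.2) && (p.2 < f p.1)].
Proof.
move=> mf; apply: measurable_set_bool; apply: measurable_and.
  exact: measurable_fun_ler.
by apply: measurable_fun_ltr => //; exact: measurableT_comp.
Qed.

(** Each value [f y] is the length of [[0, f y[], and Tonelli exchanges the two integrals. The
    weight [g] is extended-valued so that a possibly infinite constant can serve as weight later. *)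
Lemma integral_layer_cake d1 (X : measurableType d1) d (Y : measurableType d)
  (m : {sigma_finite_measure set X -> \bar R}) (phi : X -> Y)
  (g : X -> \bar R) (f : Y -> R) :
  measurable_fun setT phi -> measurable_fun setT g -> measurable_fun setT f ->
  (forall x, 0 <= g x)%E -> (forall y, 0 <= f y) ->
  (\int[m]_x (g x * (f (phi x))%:E) =
   \int[mu]_t \int[m]_x
     (g x * (\1_[set y | (0 <= t)%R && (t < f y)%R] (phi x))%:E))%E.
Proof.
move=> mphi mg mf g0 f0.
pose A := [set p : Y * R | (0 <= p.2) && (p.2 < f p.1)].
pose h (p : X * R) := (g p.1 * (\1_A (phi p.1, p.2))%:E)%E.
have mA : measurable_fun setT (\1_A : Y * R -> R).
  by apply: measurable_indic; exact: measurable_subgraph.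
have mh : measurable_fun setT h.
  apply: emeasurable_funM; first exact: measurableT_comp.
  apply/measurable_EFinP; apply: (measurableT_comp mA).
  by apply: measurable_fun_pair => //; exact: measurableT_comp.
have h0 p : (0 <= h p)%E by rewrite mule_ge0// lee_fin.
transitivity (\int[m]_x \int[mu]_t h (x, t))%E; last first.
  rewrite (@fubini_tonelli _ _ _ _ _ m mu h mh h0); apply: eq_integral => t _.
  apply: eq_integral => x _; rewrite /h/= !indicE; congr (_ * (nat_of_bool _)%:R%:E)%E.
have mAx x : measurable_fun setT (fun t : R => (\1_A (phi x, t) : R)%:E).
  have mp : measurable_fun setT (fun t : R => (phi x, t)).
    exact: measurable_fun_pair.
  by apply/measurable_EFinP; exact: (measurableT_comp mA mp).
apply: eq_integral => x _; rewrite /h/= ge0_integralZl//; last exact: mAx.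
by rewrite -[in LHS](integral_subgraph (f (phi x))).
Qed.

(* It suffices to compare the two weighted laws on measurable sets: the layer cake
   formula writes f as a superposition of indicators. *)
Lemma integral_transfer d1 (X1 : measurableType d1) d2 (X2 : measurableType d2)
  d (Y : measurableType d)
  (m1 : {sigma_finite_measure set X1 -> \bar R})
  (m2 : {sigma_finite_measure set X2 -> \bar R})
  (phi1 : X1 -> Y) (phi2 : X2 -> Y)
  (g1 : X1 -> \bar R) (g2 : X2 -> \bar R) (f : Y -> R) :
  measurable_fun setT phi1 -> measurable_fun setT phi2 ->
  measurable_fun setT g1 -> measurable_fun setT g2 -> measurable_fun setT f ->
  (forall x, 0 <= g1 x)%E -> (forall x, 0 <= g2 x)%E -> (forall y, 0 <= f y) ->
  (forall B, measurable B -> \int[m1]_x (g1 x * (\1_B (phi1 x))%:E) =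
                             \int[m2]_x (g2 x * (\1_B (phi2 x))%:E))%E ->
  (\int[m1]_x (g1 x * (f (phi1 x))%:E) = \int[m2]_x (g2 x * (f (phi2 x))%:E))%E.
Proof.
move=> mphi1 mphi2 mg1 mg2 mf g10 g20 f0 gE.
rewrite integral_layer_cake// [RHS]integral_layer_cake//.
apply: eq_integral => t _; apply: gE.
apply: measurable_set_bool; apply: measurable_and.
  exact: measurable_fun_ler.
exact: measurable_fun_ltr.
Qed.

End transfer.

(** * Expectation of a product of independent nonnegative factors *)

Section independence.
Context {R : realType} {d} {T : measurableType d} {P : probability T R}.

Lemma integral_prod_independent (J : finType) (X : J -> T -> R)
  (F : J -> R -> R) :
  mutually_independent P X ->
  (forall j, measurable_fun setT (F j)) -> (forall j x, 0 <= F j x) ->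
  (\int[P]_t (\prod_j F j (X j t))%:E =
   \prod_j \int[P]_t (F j (X j t))%:E)%E.
Proof.
move=> [mX PX].
(* Replace the indicators by arbitrary functions one index of s at a time. *)
suff: forall s : seq J, forall G : J -> R -> R,
    (forall j, measurable_fun setT (G j)) -> (forall j x, 0 <= G j x) ->
    (forall j, j \notin s -> exists2 B, measurable B & G j = \1_B) ->
    (\int[P]_t (\prod_j G j (X j t))%:E =
     \prod_j \int[P]_t (G j (X j t))%:E)%E.
  move=> H mF F0; apply: (H (enum J)) => // j.
  by rewrite mem_enum inE.
elim=> [G mG G0 GB|j0 s IH G mG G0 GB].
  (* Base case: every factor is an indicator, and their product is the indicator of the
     intersection, to which independence applies as defined. *)
  have /choice[B /all_and2[mB GE]] j : exists B, measurable B /\ G j = \1_B.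
    by have [//|B mB GE] := GB j; exists B.
  have mXB j : measurable (X j @^-1` B j).
    by rewrite -[X in measurable X]setTI; exact: mX.
  transitivity (P (\bigcap_(j in setT) (X j @^-1` B j))).
    rewrite -[in RHS](setIT (\bigcap_(j in _) _)) -integral_indic//; last first.
      exact: fin_bigcap_measurable.
    apply: eq_integral => t _; rewrite indicE; congr (_%:E).
    under eq_bigr do rewrite GE indicE.
    have [tB|/existsNP[j tBj]] := pselect (forall j, B j (X j t)).
      rewrite big1 => [|j _]; last by rewrite mem_set.
      by rewrite mem_set// => j _; exact: tB.
    rewrite (bigD1 j)//= memNset// mul0r memNset// => /(_ j I).
    exact: tBj.
  rewrite PX//; apply: eq_bigr => j _.
  rewrite -[in LHS](setIT (X j @^-1` _)) -integral_indic//.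
  by apply: eq_integral => t _; rewrite GE.
(* [c] gathers the expectations of the other factors. The claim compares two weights for [X j0]: the
   product of the other factors, and the constant [c], which may be infinite. By [integral_transfer]
   it suffices to test them on indicators. *)
pose c := (\prod_(j | j != j0) \int[P]_t (G j (X j t))%:E)%E.
have c0 : (0 <= c)%E.
  rewrite /c; elim/big_ind: _ => // [x y|j _]; first exact: mule_ge0.
  by apply: integral_ge0 => t _; rewrite lee_fin.
have mGX j : measurable_fun setT (fun t => (G j (X j t))%:E).
  by apply/measurable_EFinP; exact: measurableT_comp.
transitivity (\int[P]_t ((\prod_(j | j != j0) G j (X j t))%:E *
                         (G j0 (X j0 t))%:E))%E.
  by apply: eq_integral => t _; rewrite (bigD1 j0)//= EFinM muleC.
transitivity (\int[P]_t (c * (G j0 (X j0 t))%:E))%E; last first.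
  rewrite ge0_integralZl//; last by move=> t _; rewrite lee_fin.
  by rewrite muleC [RHS](bigD1 j0).
apply: integral_transfer => //.
- apply/measurable_EFinP; under eq_fun do rewrite big_mkcond.
  apply: measurable_prod => j _; case: (j != j0) => //; exact: measurableT_comp.
- by move=> t; rewrite lee_fin prodr_ge0.
move=> B mB.
(* With an indicator at [j0], the family is made of indicators outside [s], so the induction
   hypothesis applies. *)
pose H j := if j == j0 then \1_B : R -> R else G j.
transitivity (\int[P]_t (\prod_j H j (X j t))%:E)%E.
  apply: eq_integral => t _; rewrite [in RHS](bigD1 j0)//= EFinM muleC.
  rewrite {1}/H eqxx; congr (_ * (_)%:E)%E; apply: eq_bigr => j /negPf jj0.
  by rewrite /H jj0.
rewrite IH.
- rewrite (bigD1 j0)//= {1}/H eqxx ge0_integralZl//.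
  + rewrite muleC; congr (_ * _)%E; apply: eq_bigr => j /negPf jj0.
    by rewrite /H jj0.
  + apply/measurable_EFinP; apply: measurableT_comp (mX j0).
    exact: measurable_indic.
- by move=> j; rewrite /H; case: ifP => // _; exact: measurable_indic.
- by move=> j x; rewrite /H; case: ifP => // _.
- move=> j js; rewrite /H; have [_|jj0] := eqVneq j j0; first by exists B.
  by apply: GB; rewrite inE negb_or jj0.
Qed.

End independence.

(** * Gaussian integrals and moment generating functions *)

Section gaussian.
Context {R : realType}.
Implicit Types (s c x v : R).

(** Completing the square: exponential tilting moves the mean to [s ^+ 2 * c] and leaves a constant
    factor. *)
Lemma integral_normal_pdf_expR s c : s != 0 ->
  (\int[mu]_x (normal_pdf 0 s x * expR (c * x))%:E =
   (expR (s ^+ 2 * c ^+ 2 / 2))%:E)%E.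
Proof.
move=> s0.
transitivity (\int[mu]_x ((expR (s ^+ 2 * c ^+ 2 / 2))%:E *
                          (normal_pdf (s ^+ 2 * c) s x)%:E))%E.
  apply: eq_integral => x _; rewrite -EFinM !normal_pdfE//.
  congr _%:E; rewrite /= -[LHS]mulrA [RHS]mulrCA; congr (_ * _).
  rewrite /normal_fun -!expRD.
  by congr expR; field.
rewrite ge0_integralZl_EFin ?expR_ge0//.
- by rewrite integral_normal_pdf mule1.
- by move=> x _; rewrite lee_fin normal_pdf_ge0.
- by apply/measurable_EFinP; exact: measurable_normal_pdf.
Qed.

(** The integrand is again a centred Gaussian density, of standard deviation [s / a] with
    [a ^+ 2 = 1 - v * s ^+ 2]; the change of the peak leaves the factor [a^-1]. *)
Lemma integral_normal_pdf_expR_sqr s v : s != 0 -> v * s ^+ 2 < 1 ->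
  (\int[mu]_x (normal_pdf 0 s x * expR (v / 2 * x ^+ 2))%:E =
   ((Num.sqrt (1 - v * s ^+ 2))^-1)%:E)%E.
Proof.
move=> s0 vs1.
have a0 : 0 < 1 - v * s ^+ 2 by rewrite subr_gt0.
set a := Num.sqrt (1 - v * s ^+ 2).
have a_gt0 : 0 < a by rewrite sqrtr_gt0.
have aE : a ^+ 2 = 1 - v * s ^+ 2 by rewrite sqr_sqrtr// ltW.
have sa0 : s / a != 0 by rewrite mulf_neq0// invr_eq0 gt_eqF.
transitivity (\int[mu]_x ((a^-1)%:E * (normal_pdf 0 (s / a) x)%:E))%E.
  apply: eq_integral => x _; rewrite -EFinM !normal_pdfE//.
  congr _%:E; rewrite /= -[LHS]mulrA [RHS]mulrA /normal_fun -expRD.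
  congr (_ * expR _).
    rewrite /normal_peak.
    have -> : (s / a) ^+ 2 * pi *+ 2 = (s ^+ 2 * pi *+ 2) * a^-1 ^+ 2 by ring.
    rewrite sqrtrM; last by rewrite mulrn_wge0// mulr_ge0 ?sqr_ge0 ?pi_ge0.
    rewrite sqrtr_sqr gtr0_norm ?invr_gt0// invfM invrK mulrCA mulVf ?mulr1//.
    by rewrite gt_eqF.
  rewrite subr0 exprMn exprVn aE; field.
  by rewrite s0 -aE sqrf_eq0 gt_eqF.
rewrite ge0_integralZl_EFin ?invr_ge0 ?(ltW a_gt0)//.
- by rewrite integral_normal_pdf mule1.
- by move=> x _; rewrite lee_fin normal_pdf_ge0.
- by apply/measurable_EFinP; exact: measurable_normal_pdf.
Qed.

Context {d} {T : measurableType d} {P : probability T R}.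

(** [is_normal0] gives the law on measurable sets only; the transfer lemma, with weight 1 on one
    side and the density on the other, extends it to nonnegative functions. *)
Lemma integral_is_normal0 v (X : T -> R) (f : R -> R) :
  is_normal0 P v X -> measurable_fun setT X -> measurable_fun setT f ->
  (forall x, 0 <= f x) ->
  (\int[P]_t (f (X t))%:E =
   \int[mu]_x (normal_pdf 0 (Num.sqrt v) x * f x)%:E)%E.
Proof.
move=> XN mX mf f0.
transitivity (\int[P]_t (1 * (f (X t))%:E))%E.
  by apply: eq_integral => t _; rewrite mul1e.
under [RHS]eq_integral do rewrite EFinM.
apply: (@integral_transfer R _ T _ _ _ _ P mu X id (cst 1%E)) => //.
- by apply/measurable_EFinP; exact: measurable_normal_pdf.
- by move=> x; rewrite lee_fin normal_pdf_ge0.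
move=> B mB; transitivity (P (X @^-1` B)).
  rewrite -[in RHS](setIT (X @^-1` B)) -integral_indic//; last first.
    by rewrite -[X in measurable X]setTI; exact: mX.
  by apply: eq_integral => t _; rewrite mul1e.
rewrite XN// /normal_prob integral_mkcond; apply: eq_integral => x _.
by rewrite epatch_indic.
Qed.

Lemma mgf_normal0 v (X : T -> R) c : 0 < v ->
  is_normal0 P v X -> measurable_fun setT X ->
  (\int[P]_t (expR (c * X t))%:E = (expR (v * c ^+ 2 / 2))%:E)%E.
Proof.
move=> v0 XN mX.
rewrite (integral_is_normal0 v X (fun x => expR (c * x)))//.
  by rewrite integral_normal_pdf_expR ?sqr_sqrtr ?ltW// gt_eqF// sqrtr_gt0.
by apply: measurableT_comp => //; exact: measurable_funM.
Qed.

Lemma mgf_sum_normal0 (J : finType) (X : J -> T -> R) (v c : J -> R) :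
  mutually_independent P X -> (forall j, 0 < v j) ->
  (forall j, is_normal0 P (v j) (X j)) ->
  (\int[P]_t (expR (\sum_j c j * X j t))%:E =
   (expR ((\sum_j v j * c j ^+ 2) / 2))%:E)%E.
Proof.
move=> PX v0 XN.
under eq_integral do rewrite expR_sum.
rewrite (integral_prod_independent J X (fun j x => expR (c j * x)))//.
- rewrite mulr_suml expR_sum -prodEFin; apply: eq_bigr => j _.
  by rewrite (mgf_normal0 (v j))//; exact: PX.1.
- by move=> j; apply: measurableT_comp => //; exact: measurable_funM.
Qed.

End gaussian.

(** * Exponential moment and Chernoff bound for a sum of Gaussian squares *)

Section chi_square.
Context {R : realType} {d} {T : measurableType d} {P : probability T R}.
Variables (I : finType) (Z : I -> T -> R) (v s : R).
Hypothesis mZ : forall i, measurable_fun setT (Z i).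
Hypothesis mgfZ : forall g : I -> R,
  (\int[P]_t (expR (\sum_i g i * Z i t))%:E =
   (expR (v / 2 * \sum_i g i ^+ 2))%:E)%E.
Hypotheses (s0 : 0 < s) (sv1 : 2 * s * v < 1).

(** The auxiliary variance is [2 * s] so that its half, from the Gaussian moment generating
    function, is [s]. *)
Lemma integral_hubbard_stratonovich (z : R) :
  (\int[mu]_x (normal_pdf 0 (Num.sqrt (2 * s)) x * expR (x * z))%:E =
   (expR (s * z ^+ 2))%:E)%E.
Proof.
have ss0 : 0 < 2 * s by rewrite mulr_gt0.
under eq_integral do rewrite (mulrC _ z).
rewrite integral_normal_pdf_expR ?gt_eqF ?sqrtr_gt0//.
by rewrite sqr_sqrtr ?ltW//; congr (expR _)%:E; field.
Qed.

Lemma mgf_sum_sqr :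
  (\int[P]_t (expR (s * \sum_i Z i t ^+ 2))%:E =
   ((Num.sqrt (1 - 2 * s * v))^-1 ^+ #|I|)%:E)%E.
Proof.
set a := (Num.sqrt _)^-1.
have a0 : 0 <= a by rewrite invr_ge0.
(* r lists the coordinates already squared; the others remain linear. *)
suff H (r : seq I) (g : I -> R) : uniq r ->
    (\int[P]_t (expR (\sum_i (if i \in r then s * Z i t ^+ 2
                              else g i * Z i t)))%:E =
     (a ^+ size r * expR (v / 2 * \sum_(i | i \notin r) g i ^+ 2))%:E)%E.
  have := H (enum I) (fun=> 0) (enum_uniq _).
  rewrite big1 => [|i]; last by rewrite mem_enum inE.
  rewrite mulr0 expR0 mulr1 -cardE => <-; apply: eq_integral => t _.
  by rewrite mulr_sumr; congr (expR _)%:E; apply: eq_bigr => i _; rewrite mem_enum.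
elim: r g => [|i0 r IH] g /=.
  by move=> _; rewrite mul1r mgfZ.
move=> /andP[i0r ur].
(* The square at [i0] is replaced by a linear term whose coefficient is the auxiliary Gaussian
   variable [p.2]. *)
pose f (p : T * R) i := if i \in r then s * Z i p.1 ^+ 2
                        else (if i == i0 then p.2 else g i) * Z i p.1.
pose h p := (normal_pdf 0 (Num.sqrt (2 * s)) p.2 * expR (\sum_i f p i))%:E.
have mh : measurable_fun setT h.
  apply/measurable_EFinP; apply: measurable_funM.
    exact: (measurableT_comp (measurable_normal_pdf _ _)).
  apply: measurableT_comp => //; apply: measurable_sum => i; rewrite /f.
  have mZi : measurable_fun setT (fun p : T * R => Z i p.1).
    exact: measurableT_comp.
  case: (i \in r); apply: measurable_funM => //.
    exact: measurable_funX.
  by case: (i == i0); [exact: measurable_snd|exact: measurable_cst].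
have h0 p : (0 <= h p)%E by rewrite lee_fin mulr_ge0 ?normal_pdf_ge0 ?expR_ge0.
transitivity (\int[P]_t \int[mu]_x h (t, x))%E.
  apply: eq_integral => t _; rewrite (bigD1 i0)//= mem_head expRD EFinM.
  rewrite -integral_hubbard_stratonovich muleC -ge0_integralZl//; last 2 first.
  - apply/measurable_EFinP; apply: measurable_funM.
      exact: measurable_normal_pdf.
    by apply: measurableT_comp => //; exact: measurable_funM.
  - by move=> x _; rewrite lee_fin mulr_ge0 ?normal_pdf_ge0 ?expR_ge0.
  apply: eq_integral => x _; rewrite -EFinM /h /= [in RHS](bigD1 i0)//= expRD.
  rewrite {1}/f (negbTE i0r) eqxx/=.
  have -> : \sum_(i | i != i0) f (t, x) i = \sum_(i | i != i0)
      (if i \in i0 :: r then s * Z i t ^+ 2 else g i * Z i t).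
    by apply: eq_bigr => i /negPf ii0; rewrite /f inE ii0.
  by congr _%:E; ring.
rewrite (@fubini_tonelli _ _ _ _ _ P mu h mh h0).
set c := v / 2 * \sum_(i | i \notin i0 :: r) g i ^+ 2.
(* For fixed [x], the induction hypothesis with coefficient [x] at [i0] evaluates the inner
   expectation. It produces the factor [expR (v / 2 * x ^+ 2)], whose Gaussian average is the
   additional factor [a]. *)
transitivity (\int[mu]_x ((a ^+ size r * expR c)%:E *
  (normal_pdf 0 (Num.sqrt (2 * s)) x * expR (v / 2 * x ^+ 2))%:E))%E.
  apply: eq_integral => x _; rewrite /h/=.
  under eq_integral do rewrite EFinM.
  rewrite ge0_integralZl_EFin ?normal_pdf_ge0//; last first.
    apply/measurable_EFinP; apply: measurableT_comp => //.
    apply: measurable_sum => i; rewrite /f/=.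
    case: (i \in r); apply: measurable_funM => //.
    exact: measurable_funX.
  rewrite (IH (fun i => if i == i0 then x else g i))// (bigD1 i0)//= eqxx.
  rewrite -!EFinM; congr (_%:E).
  have -> : \sum_(i | (i \notin r) && (i != i0))
              (if i == i0 then x else g i) ^+ 2 =
            \sum_(i | i \notin i0 :: r) g i ^+ 2.
    apply: eq_big => [i|i /andP[_ /negPf->]//].
    by rewrite inE negb_or andbC.
  rewrite mulrDr expRD -/c; ring.
rewrite ge0_integralZl_EFin//.
- rewrite integral_normal_pdf_expR_sqr ?sqr_sqrtr ?mulr_ge0 ?(ltW s0)//.
  + by rewrite -EFinM mulrAC exprSr (mulrC v) mulrAC.
  + by rewrite gt_eqF// sqrtr_gt0 mulr_gt0.
  + by rewrite mulrC.
- by move=> x _; rewrite lee_fin mulr_ge0 ?normal_pdf_ge0 ?expR_ge0.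
- apply/measurable_EFinP; apply: measurable_funM.
    exact: measurable_normal_pdf.
  apply: measurableT_comp => //; apply: measurable_funM => //.
- by rewrite mulr_ge0 ?exprn_ge0 ?expR_ge0.
Qed.

Lemma chernoff_sum_sqr (y : R) :
  (P [set t | (y <= \sum_i Z i t ^+ 2)%R] <=
   ((Num.sqrt (1 - 2 * s * v))^-1 ^+ #|I| * expR (- (s * y)))%:E)%E.
Proof.
have mX : measurable_fun setT (fun t => \sum_i Z i t ^+ 2).
  by apply: measurable_sum => i; exact: measurable_funX.
pose X : {RV P >-> R} := HB.pack (fun t => \sum_i Z i t ^+ 2)
  (isMeasurableFun.Build _ _ _ _ _ mX).
apply: (le_trans (chernoff X y s0)).
rewrite EFinM -mgf_sum_sqr /mmt_gen_fun unlock.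
rewrite lee_wpmul2r ?lee_fin ?expR_ge0//.
rewrite le_eqVlt; apply/orP; left; apply/eqP.
by apply: eq_integral => t _ /=; rewrite mulrC.
Qed.

End chi_square.

(** * Conjugate transposes, real coordinates and channel gains *)

Section complex_matrices.
Context {R : realType}.
Local Notation C := R[i].

Lemma ctrmxM m n p (A : 'M[C]_(m, n)) (B : 'M[C]_(n, p)) :
  ctrmx (A *m B) = ctrmx B *m ctrmx A.
Proof. by rewrite /ctrmx trmx_mul map_mxM. Qed.

(** Multiplying [A X A = A] by [A^H] gives [X A = 1]. Since [A X] is Hermitian, [X = A^H (A X) = A^H
    X^H A^H = (X A)^H A^H = A^H]. *)
Lemma is_pinv_isometry m n (A : 'M[C]_(m, n)) (X : 'M[C]_(n, m)) :
  ctrmx A *m A = 1%:M -> is_pinv A X -> X = ctrmx A.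
Proof.
move=> AA [AXA _ AXh _].
have XA : X *m A = 1%:M by rewrite -[X]mul1mx -AA -!mulmxA (mulmxA A) AXA.
rewrite -[LHS]mul1mx -AA -mulmxA -AXh ctrmxM mulmxA -ctrmxM XA.
by rewrite /ctrmx trmx1 map_mx1 mul1mx.
Qed.

Lemma abs2_cpart (z : C) : abs2 z = \sum_b cpart b z ^+ 2.
Proof. by rewrite big_bool. Qed.

(** Passes from Hermitian products to the real coordinates in which the Gaussian model is stated. *)
Lemma Re_ctrmx_mul n (x y : 'cV[C]_n) :
  complex.Re ((ctrmx x *m y) 0 0) =
  \sum_(p : 'I_n * bool) cpart p.2 (x p.1 0) * cpart p.2 (y p.1 0).
Proof.
rewrite mxE raddf_sum -(pair_bigA _ (fun i b => cpart b (x i 0) * cpart b (y i 0))).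
apply: eq_bigr => i _; rewrite big_bool !mxE /=.
by case: (x i 0) (y i 0) => a b [a' b'] /=; rewrite mulNr opprK.
Qed.

Lemma abs2_realM (r : R) (z : C) : abs2 (r%:C%C * z) = r ^+ 2 * abs2 z.
Proof. by case: z => a b; rewrite /abs2 /=; ring. Qed.

Lemma abs2_gt0 (z : C) : z != 0 -> 0 < abs2 z.
Proof.
case: z => a b; rewrite eq_complex negb_and /abs2 /= => ab0.
rewrite lt_def addr_ge0 ?sqr_ge0// paddr_eq0 ?sqr_ge0// !sqrf_eq0 negb_and.
by rewrite ab0.
Qed.

Lemma min_gain_gt0 K (h : 'I_K -> C) :
  (0 < K)%N -> (forall k, h k != 0) -> 0 < min_gain h.
Proof.
case: K h => // K h _ h0; rewrite /min_gain.
(* The default value of the minimum must be positive too; as [K] is positive, it is the gain of the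
   first user. *)
apply/bigmin_gtP; split => [|k _]; last exact: abs2_gt0.
by rewrite enum_ordSl /= abs2_gt0.
Qed.

End complex_matrices.

(** * Law of the filtered noise *)

Section matched_filter.
Context {R : realType} {d} {T : measurableType d} {P : probability T R}.
Variables (K L Lt : nat) (w : 'I_K -> T -> 'cV[R[i]]_L).
Variables (n : T -> 'cV[R[i]]_Lt) (PW N0 : R).
Hypotheses (PW0 : 0 < PW) (N00 : 0 < N0) (wn : gaussian_model P w n PW N0).

(** [Re (u^H n)] is a real combination of independent components of variance [N0 / 2]; half of this
    variance gives [N0 / 4]. *)
Lemma mgf_noise (u : 'cV[R[i]]_Lt) :
  (\int[P]_t (expR (complex.Re ((ctrmx u *m n t) 0 0)))%:E =
   (expR (N0 / 4 * complex.Re ((ctrmx u *m u) 0 0)))%:E)%E.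
Proof.
have [indep [wN nN]] := wn.
pose v (j : (('I_K * 'I_L) + 'I_Lt) * bool) :=
  if j.1 is inl _ then PW / 2 else N0 / 2.
(* Independence concerns messages and noise jointly, so the message components receive coefficient
   0. *)
pose c (j : (('I_K * 'I_L) + 'I_Lt) * bool) :=
  if j.1 is inr i then cpart j.2 (u i 0) else 0.
have sumJ (F : (('I_K * 'I_L) + 'I_Lt) * bool -> R) :
    (forall ki b, F (inl ki, b) = 0) ->
    \sum_j F j = \sum_(p : 'I_Lt * bool) F (inr p.1, p.2).
  move=> F0; rewrite -(pair_bigA _ (fun i b => F (inr i, b))).
  have -> : \sum_j F j = \sum_j \sum_b F (j, b).
    by rewrite pair_bigA; apply: eq_bigr => -[].
  by rewrite big_sumType /= big1 ?add0r// => ki _; rewrite big1.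
have -> : (\int[P]_t (expR (complex.Re ((ctrmx u *m n t) 0 0)))%:E =
           \int[P]_t (expR (\sum_j c j * components w n j t))%:E)%E.
  apply: eq_integral => t _; congr (expR _)%:E.
  by rewrite Re_ctrmx_mul sumJ// => -[k i] b; rewrite mul0r.
rewrite (mgf_sum_normal0 _ _ v)//.
- congr (expR _)%:E; rewrite sumJ => [|ki b]; last by rewrite /c expr0n mulr0.
  rewrite Re_ctrmx_mul mulr_suml mulr_sumr; apply: eq_bigr => p _.
  by rewrite /v /c /=; field.
- by case=> -[ki|i] b; rewrite /v/= divr_gt0.
- by case=> -[[k i]|i] b.
Qed.

Variable Phi : 'M[R[i]]_(Lt, L).
Hypothesis Phi1 : ctrmx Phi *m Phi = 1%:M.

Definition matched (p : 'I_L * bool) (t : T) : R :=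
  cpart p.2 ((ctrmx Phi *m n t) p.1 0).

Lemma measurable_matched p : measurable_fun setT (matched p).
Proof.
have mn i b : measurable_fun setT (fun t => cpart b (n t i 0)).
  exact: (wn.1.1 (inr i, b)).
(* Measurability is known for the real and imaginary parts of [n], so the coordinate is expanded as
   a real combination of them. *)
have -> : matched p = fun t => \sum_j
   (complex.Re (ctrmx Phi p.1 j) * cpart p.2 (n t j 0) +
    (if p.2 then -1 else 1) * complex.Im (ctrmx Phi p.1 j) *
    cpart (~~ p.2) (n t j 0)).
  apply/funext => t; rewrite /matched mxE; case: p.2.
    rewrite /= raddf_sum; apply: eq_bigr => j _.
    by case: (ctrmx _ _ _) (n t j 0) => a b [a' b'] /=; ring.
  rewrite /= raddf_sum; apply: eq_bigr => j _.
  by case: (ctrmx _ _ _) (n t j 0) => a b [a' b'] /=; ring.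
apply: measurable_sum => j; apply: measurable_funD.
  exact: measurable_funM (measurable_cst _) (mn _ _).
exact: measurable_funM (measurable_cst _) (mn _ _).
Qed.

Lemma mgf_matched (g : 'I_L * bool -> R) :
  (\int[P]_t (expR (\sum_p g p * matched p t))%:E =
   (expR (N0 / 2 / 2 * \sum_p g p ^+ 2))%:E)%E.
Proof.
(* Read as a complex vector [y], the coefficients turn the linear form into [Re ((Phi y)^H n)], and
   [Phi] preserves the norm of [y]. *)
pose y : 'cV[R[i]]_L := \col_i (g (i, true) +i* g (i, false))%C.
have gE (p : 'I_L * bool) : g p = cpart p.2 (y p.1 0).
  by case: p => i []; rewrite mxE.
have -> : \sum_p g p ^+ 2 = complex.Re ((ctrmx (Phi *m y) *m (Phi *m y)) 0 0).
  rewrite ctrmxM mulmxA -(mulmxA (ctrmx y)) Phi1 mulmx1 Re_ctrmx_mul.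
  by apply: eq_bigr => p _; rewrite -gE.
have -> : N0 / 2 / 2 = N0 / 4 by field.
rewrite -mgf_noise; apply: eq_integral => t _; congr (expR _)%:E.
rewrite ctrmxM -mulmxA Re_ctrmx_mul; apply: eq_bigr => p _.
by rewrite gE.
Qed.

End matched_filter.

(** * Distortion as filtered noise energy, and the final tail bound *)

Lemma distortion_matched (R : realType) d (T : measurableType d) K L Lt
  (Phi : 'M[R[i]]_(Lt, L)) (Phid : 'M[R[i]]_(L, Lt)) (Pw : R)
  (w : 'I_K -> T -> 'cV[R[i]]_L) (n : T -> 'cV[R[i]]_Lt) (t : T) :
  ctrmx Phi *m Phi = 1%:M -> is_pinv Phi Phid -> 0 < Pw ->
  distortion (\sum_k w k t) (estimate Phi Phid Pw w n t) =
  (L%:R * Pw)^-1 * \sum_p matched L Lt n Phi p t ^+ 2.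
Proof.
move=> Phi1 pinv Pw0; rewrite (is_pinv_isometry _ _ _ _ Phi1 pinv).
rewrite /distortion invfM -mulrA; congr (_ * _).
have s0 : (Num.sqrt Pw)%:C%C != 0 :> R[i].
  by rewrite -[X in _ != X](rmorph0 (real_complex R)) (inj_eq (@complexI R))
    gt_eqF// sqrtr_gt0.
rewrite -(pair_bigA _ (fun i b => matched L Lt n Phi (i, b) t ^+ 2)) mulr_sumr.
apply: eq_bigr => i _; rewrite -(abs2_cpart ((ctrmx Phi *m n t) i 0)).
have -> : Pw^-1 = ((Num.sqrt Pw)^-1) ^+ 2 by rewrite exprVn sqr_sqrtr ?ltW.
rewrite -abs2_realM; congr abs2.
(* The signal part is recovered exactly, so the error is [Phi^H n / sqrt Pw]. *)
rewrite /estimate /received mulmxDr -scalemxAr mulmxA Phi1 mul1mx scalerDr.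
by rewrite scalerA mulVf// scale1r [X in X - _]mxE addrAC subrr add0r mxE fmorphV.
Qed.

(** Take logarithms; strict positivity of [eta - ln (1 + eta)] allows clearing the denominator in
    the bound on [L]. *)
Lemma chernoff_exponent (R : realType) (L : nat) (eta delta : R) :
  0 < eta -> 0 < delta -> ln (delta^-1) / (eta - ln (1 + eta)) <= L%:R ->
  (1 + eta) ^+ L * expR (- (L%:R * eta)) <= delta.
Proof.
move=> eta0 d0.
have e1 : 0 < 1 + eta by rewrite addr_gt0.
have ln_lt : ln (1 + eta) < eta.
  by rewrite -ltr_expR lnK ?posrE// expR_gt1Dx ?gt_eqF.
rewrite ler_pdivrMr ?subr_gt0// lnV ?posrE// => Lge.
rewrite -[X in X ^+ _](lnK e1) -expRM_natl -expRD -[leRHS](lnK d0) ler_expR.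
by move: Lge; rewrite mulrBr; lra.
Qed.

Theorem theorem4 (R : realType) (d : measure_display) (T : measurableType d)
  (Pr : probability T R) (K L Lt : nat) (h : 'I_K -> R[i])
  (PW PX N0 eps eta delta : R)
  (w : 'I_K -> T -> 'cV[R[i]]_L) (n : T -> 'cV[R[i]]_Lt)
  (Phi : 'M[R[i]]_(Lt, L)) (Phid : 'M[R[i]]_(L, Lt)) :
  (0 < K)%N ->
  (forall k, h k != 0) ->
  0 < PW -> 0 < PX -> 0 < N0 -> 0 < eps -> 0 < eta -> 0 < delta < 1 ->
  gaussian_model Pr w n PW N0 ->
  let rhoX := PX / N0 in
  let Rc := L%:R / Lt%:R in
  L%:R >= ln (delta^-1) / (eta - ln (1 + eta)) ->
  0 < Rc -> Rc <= Num.min 1 (eps * rhoX * min_gain h / ((1 + eta) * PW)) ->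
  admissible Phi -> ctrmx Phi *m Phi = 1%:M ->
  is_pinv Phi Phid ->
  let Pstar := PX * min_gain h / (Rc * PW) in
  let gamma_opt := Rc * PW / (rhoX * min_gain h) in
  eps >= (1 + eta) * gamma_opt /\
  (Pr [set t | (distortion (\sum_k w k t) (estimate Phi Phid Pstar w n t) <= eps)%R]
     >= (1 - delta)%:E)%E.
Proof.
move=> K0 h0 PW0 PX0 N00 eps0 eta0 /andP[d0 d1] wn rhoX Rc Lge Rc0.
rewrite le_min => /andP[_ Rcle] _ Phi1 pinv Pstar gamma_opt.
have mg0 : 0 < min_gain h by exact: min_gain_gt0.
have rho0 : 0 < rhoX by rewrite divr_gt0.
have e1 : 0 < 1 + eta by rewrite addr_gt0.
have Pstar0 : 0 < Pstar by apply: divr_gt0; apply: mulr_gt0.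
have gamma_le : (1 + eta) * gamma_opt <= eps.
  rewrite /gamma_opt mulrA ler_pdivrMr; last exact: mulr_gt0.
  by rewrite mulrCA [leRHS]mulrA -ler_pdivlMr// mulr_gt0.
split; first exact: gamma_le.
(* [gamma_opt] is thus the noise variance [N0 / Pstar] after power scaling. *)
have Pgamma : Pstar * gamma_opt = N0.
  by rewrite /Pstar /gamma_opt /rhoX; field; rewrite !gt_eqF.
have L0 : 0 < L%:R :> R.
  by rewrite ltr0n lt0n; apply/eqP => L0; move: Rc0; rewrite /Rc L0 mul0r ltxx.
pose y := L%:R * Pstar * eps.
(* This [s] minimises [(1 - s N0)^(-L) exp (- s y)] in the boundary case
   [eps = (1 + eta) gamma_opt], where [y = L N0 (1 + eta)]. *)
pose s := eta / ((1 + eta) * N0).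
have s0 : 0 < s by rewrite divr_gt0 ?mulr_gt0.
have sN : 1 - 2 * s * (N0 / 2) = (1 + eta)^-1.
  by rewrite /s; field; rewrite !gt_eqF.
have sv1 : 2 * s * (N0 / 2) < 1 by rewrite -subr_gt0 sN invr_gt0.
(* The ratio of [s * y] to [L * eta] is [eps / ((1 + eta) gamma_opt)], which is at least 1. *)
have sy : L%:R * eta <= s * y.
  have -> : s * y = L%:R * eta * (Pstar * eps / (N0 * (1 + eta))).
    rewrite /s /y; clearbody Pstar.
    by field; rewrite !gt_eqF.
  apply: ler_peMr; first by rewrite mulr_ge0// ltW.
  rewrite ler_pdivlMr; last exact: mulr_gt0.
  by rewrite mul1r -Pgamma -mulrA ler_pM2l// mulrC.
pose Z := matched L Lt n Phi.
have mZ p : measurable_fun setT (Z p) by exact: measurable_matched wn _ _.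
(* The Chernoff bound concerns the closed event [A]; the complement of [A] lies in the event of
   distortion at most [eps]. *)
pose A := [set t | y <= \sum_p Z p t ^+ 2].
have mSum : measurable_fun setT (fun t => \sum_p Z p t ^+ 2).
  by apply: measurable_sum => p; exact: measurable_funX.
have mA : measurable A.
  by apply: measurable_set_bool; exact: measurable_fun_ler.
have PA : (Pr A <= delta%:E)%E.
  have := chernoff_sum_sqr _ Z (N0 / 2) s mZ
    (mgf_matched K L Lt w n PW N0 PW0 N00 wn Phi Phi1) s0 sv1 y.
  move=> /le_trans; apply; rewrite lee_fin sN.
  (* There are [2 L] real coordinates, each contributing [sqrt (1 + eta)], hence
     [(1 + eta) ^+ L]. *)
  rewrite card_prod card_ord card_bool mulnC exprM sqrtrV ?(ltW e1)// invrK.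
  rewrite sqr_sqrtr ?(ltW e1)//.
  apply: le_trans _ (chernoff_exponent _ _ _ _ eta0 d0 Lge).
  by rewrite ler_pM2l ?exprn_gt0// ler_expR lerN2.
have -> : [set t | distortion (\sum_k w k t) (estimate Phi Phid Pstar w n t)
                   <= eps] = [set t | \sum_p Z p t ^+ 2 <= y].
  apply/eq_set => t; rewrite distortion_matched//.
  by rewrite ler_pdivrMl//; exact: mulr_gt0.
apply: (@le_trans _ _ (Pr (~` A))).
  by rewrite probability_setC// EFinB leeB.
apply: le_measure; rewrite ?inE.
- exact: measurableC.
- by apply: measurable_set_bool; exact: measurable_fun_ler.
- by move=> t /= /negP; rewrite -ltNge => /ltW.
Qed.
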